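(* Let $d\ge2$ and integers $u_1,\dots,u_d\ge 2$ be fixed, let $\mathscr{P}=\prod_{j=1}^d\{1,2,\dots,u_j\}$, and let $u=\prod_{j=1}^d u_j$. Let $\mathbf{p}_1,\dots,\mathbf{p}_n$ be independent points uniformly distributed on $\mathscr{P}$, and for $1\le k\le d$ let $M^{[c]}_{d,k}(n)$ be the number of $k$-dominant skyline points of $\{\mathbf{p}_1,\dots,\mathbf{p}_n\}$ (counted with multiplicity over indices $i=1,\dots,n$). Then for every $1\le k\le d$, \[ \frac{\mathbb{E}[M^{[c]}_{d,k}(n)]}{n}\to \frac1u\qquad (n\to\infty). \]
   Context: For points $\mathbf{p}=(p_1,\dots,p_d)$, $\mathbf{q}=(q_1,\dots,q_d)$, $\mathbf{p}$ $k$-dominates $\mathbf{q}$ if there is a set $S$ of $k$ coordinates such that $p_j\le q_j$ for all $j\in S$ and $p_j<q_j$ for at least one $j\in S$. A point $\mathbf{p}_i$ of the sample is a $k$-dominant skyline point if no $\mathbf{p}_\ell$, $\ell\ne i$, $k$-dominates it. *)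

(* Defs.v *)
From HB Require Import structures.
From mathcomp Require Import all_boot all_order all_algebra.
From mathcomp Require Import all_classical all_reals all_analysis.

Set Implicit Arguments.
Unset Strict Implicit.
Unset Printing Implicit Defensive.

Import Order.TTheory GRing.Theory Num.Theory.
Import numFieldNormedType.Exports.

Local Open Scope classical_set_scope.
Local Open Scope ring_scope.

Definition grid_point (d : nat) : Type := {ffun 'I_d -> nat}.

(* Points form a countable set, which carries the discrete sigma-algebra. *)
HB.instance Definition _ (d : nat) := Choice.on (grid_point d).
HB.instance Definition _ (d : nat) :=
  isPointed.Build (grid_point d) [ffun=> 0%N].
HB.instance Definition _ (d : nat) :=
  @isMeasurable.Build default_measure_display (grid_point d)
    discrete_measurable discrete_measurable0
    discrete_measurableC discrete_measurableU.

Definition box (d : nat) (u : 'I_d -> nat) : set (grid_point d) :=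
  [set q : grid_point d | forall j : 'I_d, (1 <= q j <= u j)%N].

Definition kdominates (d k : nat) (p q : grid_point d) : bool :=
  [exists S : {set 'I_d},
    [&& #|S| == k,
        [forall j in S, (p j <= q j)%N] &
        [exists j in S, (p j < q j)%N]]].

Definition kskyline (d k n : nat) (x : 'I_n -> grid_point d) (i : 'I_n) : bool :=
  [forall l : 'I_n, (l != i) ==> ~~ kdominates k (x l) (x i)].

Definition num_kskyline (d k n : nat) (x : 'I_n -> grid_point d) : nat :=
  #|[pred i | kskyline k x i]|.

Definition mutually_independent (dT dE : measure_display)
    (T : measurableType dT) (E : measurableType dE) (R : realType)
    (P : probability T R) (I : finType) (X : I -> {RV P >-> E}) : Prop :=
  forall (J : {set I}) (A : I -> set E),
    (forall i, i \in J -> measurable (A i)) ->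
    P (\bigcap_(i in [set` J]) (X i @^-1` A i)) =
      (\prod_(i in J) P (X i @^-1` A i))%E.

(* The masses at the points of the box add up to 1, so no mass lies outside. *)
Definition uniform_on_box (d : nat) (u : 'I_d -> nat) (dT : measure_display)
    (T : measurableType dT) (R : realType) (P : probability T R)
    (X : {RV P >-> grid_point d}) : Prop :=
  forall q : grid_point d, box u q ->
    distribution P X [set q] = (((\prod_(j < d) u j)%N%:R)^-1)%:E.

(* Main.v *)
Require Import Defs.
From mathcomp Require Import all_boot all_order all_algebra.
From mathcomp Require Import all_classical all_reals all_analysis.
From mathcomp Require Import measurable_realfun.

Import Order.TTheory GRing.Theory Num.Theory.
Import numFieldNormedType.Exports.

Local Open Scope classical_set_scope.
Local Open Scope ring_scope.

(** The point (1, ..., 1) is k-dominated by no point of the box and k-dominates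
    every other point of the box, whatever k >= 1 is.  Hence the i-th sample
    point is almost surely in the skyline when it equals (1, ..., 1), an event of
    probability 1/u, and it can be in the skyline otherwise only if no other
    sample point equals (1, ..., 1), an event of probability at most
    (1 - 1/u)^(n-1).  Averaging over i squeezes E[M]/n between 1/u and
    1/u + (1 - 1/u)^(n-1). *)

Definition ones (d : nat) : grid_point d := [ffun=> 1%N].

Lemma box_ones {d : nat} {u : 'I_d -> nat} :
  (forall j, 0 < u j)%N -> box u (ones d).
Proof. by move=> u0 j; rewrite ffunE u0. Qed.

(** List [i] first and the other elements after it. The first [k] entries form the set, and [1 <= k]
    keeps [i] among them. *)
Lemma exists_subset_card_mem {I : finType} (i : I) (k : nat) :
  (1 <= k <= #|I|)%N -> exists2 S : {set I}, #|S| = k & i \in S.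
Proof.
case/andP=> k1 kI; pose s := i :: enum (predC1 i).
have us : uniq s by rewrite /= enum_uniq mem_enum inE eqxx.
have ss : size s = #|I| by rewrite /= -cardE cardC1 prednK// (leq_trans k1).
exists [set x in take k s]%SET.
  by rewrite cardsE (card_uniqP (take_uniq _ us)) size_takel ?ss.
by case: k k1 {kI} => // k _; rewrite inE /= mem_head.
Qed.

(** Coordinates in the box are at least 1, so the weak inequalities hold on any [S]. It remains to
    put into [S] a coordinate where [q] differs from 1. *)
Lemma kdominates_ones {d k : nat} {u : 'I_d -> nat} {q : grid_point d} :
  (1 <= k <= d)%N -> box u q -> q <> ones d -> kdominates k (ones d) q.
Proof.
move=> hk bq qN1.
have [j qj] : exists j : 'I_d, q j != 1%N.
  apply/existsP; apply: contra_notT qN1 => /existsPn h.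
  by apply/ffunP => j; rewrite ffunE; apply/eqP; rewrite -[_ == _]negbK h.
have [|S Sk jS] := @exists_subset_card_mem _ j k; first by rewrite card_ord.
apply/existsP; exists S; rewrite Sk eqxx /=; apply/andP; split.
  by apply/forall_inP => l _; rewrite ffunE; case/andP: (bq l).
apply/exists_inP; exists j => //; rewrite ffunE ltn_neqAle eq_sym qj /=.
by case/andP: (bq j).
Qed.

(** A strict inequality would force a coordinate 0, which the box excludes. *)
Lemma kdominates_onesr {d k : nat} {u : 'I_d -> nat} {q : grid_point d} :
  box u q -> kdominates k q (ones d) = false.
Proof.
move=> bq; apply/existsP => -[S /and3P[_ _ /exists_inP[j _]]].
by rewrite ffunE ltnS leqn0 => /eqP qj; have := bq j; rewrite qj.
Qed.

(** Dependent functions let the range vary with the coordinate and have a product as cardinality.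
    The successor turns ['I_(u j)] into the range from 1 to [u j]. *)
Definition box_seq {d : nat} (u : 'I_d -> nat) : seq (grid_point d) :=
  [seq ([ffun j => (f j).+1] : grid_point d) | f : {dffun forall j, 'I_(u j)}].

Lemma box_seqP {d : nat} {u : 'I_d -> nat} : [set` box_seq u] = box u.
Proof.
apply/seteqP; split => q /=.
  by move=> /mapP[f _ ->] j; rewrite ffunE /= ltn_ord.
move=> bq.
have lt_q j : ((q j).-1 < u j)%N by have := bq j; case: (q j).
apply/mapP; exists [ffun j => Ordinal (lt_q j)]; first by rewrite mem_enum.
by apply/ffunP => j; rewrite !ffunE /= prednK//; case/andP: (bq j).
Qed.

Lemma box_seq_uniq {d : nat} {u : 'I_d -> nat} : uniq (box_seq u).
Proof.
rewrite map_inj_uniq ?enum_uniq// => f g fg; apply/ffunP => j.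
by have /ffunP/(_ j) := fg; rewrite !ffunE => -[/val_inj].
Qed.

Lemma size_box_seq {d : nat} {u : 'I_d -> nat} :
  size (box_seq u) = (\prod_(j < d) u j)%N.
Proof.
rewrite size_map -cardE card_dep_ffun foldrE big_map enumT.
by apply: eq_bigr => j _; rewrite card_ord.
Qed.

Lemma grid_measurable {d : nat} (A : set (grid_point d)) : measurable A.
Proof. by []. Qed.

Section RandomPoints.
Context {R : realType} {d : nat} {u : 'I_d -> nat}.
Context {dT : measure_display} {T : measurableType dT} {P : probability T R}.
Context (u0 : forall j, (0 < u j)%N).

Let U : R := (\prod_(j < d) u j)%N%:R.

Lemma card_box_ge1 : 1 <= U.
Proof. by rewrite ler1n prodn_gt0. Qed.

Lemma preimage_measurable (X : {RV P >-> grid_point d}) A :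
  measurable (X @^-1` A).
Proof. by rewrite -[_ @^-1` _]setTI; apply: measurable_funP. Qed.

(** The box is a disjoint union of [U] singletons, each of mass [U^-1]. *)
Lemma uniform_prob_box {X : {RV P >-> grid_point d}} :
  uniform_on_box u X -> P (X @^-1` box u) = 1%E.
Proof.
move=> unifX.
have -> : X @^-1` box u = \bigcup_(q in box u) X @^-1` [set q].
  apply/seteqP; split => w /=; first by move=> bw; exists (X w).
  by move=> [q bq /= ->].
rewrite measure_fin_bigcup; first last.
- by move=> q _; exact: preimage_measurable.
- by move=> q r _ _ [w [/= -> ]].
- by rewrite -box_seqP; exact: finite_seq.
rewrite (eq_fsbigr (fun=> U^-1%:E)); last first.
  by move=> q; rewrite inE => /unifX.
rewrite -box_seqP -fsbig_seq ?box_seq_uniq//.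
rewrite sumEFin big_const_seq count_predT iter_addr_0 size_box_seq.
by rewrite -mulr_natl mulfV// gt_eqF// (lt_le_trans ltr01 card_box_ge1).
Qed.

Lemma uniform_prob_ones {X : {RV P >-> grid_point d}} :
  uniform_on_box u X -> P (X @^-1` [set ones d]) = U^-1%:E.
Proof. by move=> /(_ _ (box_ones u0)). Qed.

Context {n k : nat} (X : 'I_n -> {RV P >-> grid_point d}).
Context (hk : (1 <= k <= d)%N).
Context (unifX : forall i, uniform_on_box u (X i)).
Context (indepX : mutually_independent X).

Definition skyline_event (i : 'I_n) : set T :=
  [set w | kskyline k (fun l => X l w) i].

(** Once the value [q] of [X i] is fixed, the event is a finite intersection of preimages. There are
    only countably many values [q]. *)
Lemma skyline_event_measurable i : measurable (skyline_event i).
Proof.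
have -> : skyline_event i = \bigcup_(q : grid_point d)
    (X i @^-1` [set q] `&`
     \bigcap_(l in [set l | l != i]) X l @^-1` [set r | ~~ kdominates k r q]).
  apply/seteqP; split => w /=.
    move=> /forallP h; exists (X i w) => //; split => // l /= li.
    by have := h l; rewrite li.
  move=> [q _ [/= <- h]]; apply/forallP => l; apply/implyP => li.
  exact: h.
apply: countable_bigcupT_measurable.
  exact: (@countableP {ffun 'I_d -> nat}).
move=> q; apply: measurableI; first exact: preimage_measurable.
apply: fin_bigcap_measurable => [|l _]; first exact: finite_finset.
exact: preimage_measurable.
Qed.

(** The count is a sum of indicators, so this is linearity of the integral. *)
Lemma expectation_num_kskyline :
  ('E_P[fun w => (num_kskyline k (fun i => X i w))%:R] =
   \sum_(i < n) P (skyline_event i))%E.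
Proof.
rewrite unlock.
under eq_integral => w _.
  have -> : (num_kskyline k (fun i => X i w))%:R%:E =
      (\sum_(i < n) (\1_(skyline_event i) w)%:E)%E :> \bar R.
    rewrite sumEFin /num_kskyline -sum1_card natr_sum big_mkcond /=.
    congr EFin; apply: eq_bigr => i _; rewrite indicE.
    have -> : (w \in skyline_event i) = kskyline k (fun i => X i w) i.
      by apply/idP/idP; rewrite inE.
    by rewrite inE; case: kskyline.
  over.
rewrite ge0_integral_sum//=.
- apply: eq_bigr => i _; rewrite integral_indic ?setIT//.
  exact: skyline_event_measurable.
- move=> i; apply/measurable_EFinP/measurable_indic.
  exact: skyline_event_measurable.
Qed.

Lemma skyline_event_ge i : (U^-1%:E <= P (skyline_event i))%E.
Proof.
(* If [X i] is [ones d] and the other points lie in the box, nothing dominates [X i]. By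
   independence this has probability [U^-1] times factors 1. *)
pose A l := if l == i then [set ones d] else box u.
have <- : P (\bigcap_(l in [set` [set: 'I_n]%SET]) (X l @^-1` A l)) = U^-1%:E.
  rewrite indepX; last by move=> *; exact: grid_measurable.
  rewrite (bigD1 i) ?finset.in_setT//= /A eqxx uniform_prob_ones//.
  rewrite big1 ?mule1// => l /andP[_ li].
  by rewrite (negbTE li) uniform_prob_box.
apply: le_measure; rewrite ?inE.
- apply: fin_bigcap_measurable => [|l _]; first exact: finite_finset.
  exact: preimage_measurable.
- exact: skyline_event_measurable.
move=> w h; apply/forallP => l; apply/implyP => li.
have : A i (X i w) by apply: h; rewrite /= inE.
rewrite /A eqxx => /= ->.
have : A l (X l w) by apply: h; rewrite /= inE.
by rewrite /A (negbTE li) => /kdominates_onesr ->.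
Qed.

Lemma skyline_event_le i :
  (P (skyline_event i) <= (U^-1 + (1 - U^-1) ^+ n.-1)%:E)%E.
Proof.
(* [B]: no sample point other than the [i]-th equals [ones d]. It involves [n.-1] independent
   conditions, whence the exponent. *)
pose B := \bigcap_(l in [set` [set~ i]%SET]) (X l @^-1` (~` [set ones d])).
have mB : measurable B.
  apply: fin_bigcap_measurable => [|l _]; first exact: finite_finset.
  exact: preimage_measurable.
have PB : P B = ((1 - U^-1) ^+ n.-1)%:E.
  rewrite /B indepX; last by move=> *; exact: grid_measurable.
  under eq_bigr => l _.
    rewrite -preimage_setC probability_setC; last exact: preimage_measurable.
    rewrite uniform_prob_ones// -EFinB.
    over.
  by rewrite prodEFin prodr_const cardsC1 card_ord.
have PbC : P (X i @^-1` (~` box u)) = 0%E.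
  rewrite -preimage_setC probability_setC; last exact: preimage_measurable.
  by rewrite uniform_prob_box// subee.
have m1 := preimage_measurable (X i) [set ones d].
have mb := preimage_measurable (X i) (~` box u).
(* Union bound. The middle event is null; it is included because [X i] lies in the box only almost
   surely. *)
apply: (@le_trans _ _ (P (X i @^-1` [set ones d] `|`
                          (X i @^-1` (~` box u) `|` B)))).
  apply: le_measure; rewrite ?inE.
  - exact: skyline_event_measurable.
  - by do 2?apply: measurableU.
  move=> w /forallP h.
  have [|xN1] := pselect (X i w = ones d); first by left.
  have [bx|] := pselect (box u (X i w)); last by right; left.
  right; right => l /=; rewrite !inE => li xl.
  by have := h l; rewrite li /= xl (kdominates_ones hk bx).
rewrite EFinD -(uniform_prob_ones (unifX i)) -PB -[P B]add0e -PbC.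
apply: le_trans (measureU2 _ m1 (measurableU _ _ mb mB)) _.
by rewrite leeD2l// measureU2.
Qed.

End RandomPoints.

Theorem theorem4 (R : realType) (d : nat) (u : 'I_d -> nat)
    (hd : (2 <= d)%N) (hu : forall j : 'I_d, (2 <= u j)%N)
    (dT : nat -> measure_display)
    (T : forall n : nat, measurableType (dT n))
    (P : forall n : nat, probability (T n) R)
    (p : forall n : nat, 'I_n -> {RV (P n) >-> grid_point d})
    (hunif : forall (n : nat) (i : 'I_n), uniform_on_box u (p n i))
    (hindep : forall n : nat, mutually_independent (p n))
    (k : nat) (hk : (1 <= k <= d)%N) :
  ('E_(P n)[fun w => (num_kskyline k (fun i : 'I_n => p n i w))%:R]
     * (n%:R^-1)%:E)%E @[n --> \oo]
  --> (((\prod_(j < d) u j)%N%:R : R)^-1)%:E.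
Proof.
have u0 j : (0 < u j)%N by exact: ltnW.
set U : R := _%:R.
have U1 : 1 <= U := card_box_ge1 u0.
have U0 : 0 < U := lt_le_trans ltr01 U1.
have cU : U^-1%:E @[n --> \oo] --> U^-1%:E by exact: cvg_cst.
have cV : (U^-1 + (1 - U^-1) ^+ n)%:E @[n --> \oo] --> U^-1%:E.
  apply: cvg_EFin; first by near=> n.
  rewrite -[X in _ --> X]addr0; apply: cvgD; first exact: cvg_cst.
  (* The ratio [1 - U^-1] lies in [0, 1) because [1 <= U]. *)
  apply: cvg_expr; rewrite ger0_norm ?subr_ge0 ?invf_le1//.
  by rewrite ltrBlDr ltrDl invr_gt0.
(* Passing to [n.+1] points makes the division legitimate and turns the exponent [n.-1] of the upper
   bound into [n]. *)
rewrite -cvg_shiftS; apply: squeeze_cvge cU cV.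
apply: nearW => n; rewrite /= (expectation_num_kskyline (p n.+1)).
have n0 : (0 < n.+1%:R^-1 :> R) by rewrite invr_gt0.
(* Writing each bound as an average of equal terms reduces the comparison to one index [i] at a
   time. *)
have avg (c : R) : c%:E = ((\sum_(i < n.+1) c%:E) * (n.+1%:R^-1)%:E)%E.
  by rewrite sumEFin sumr_const card_ord -EFinM -[c *+ _]mulr_natr mulfK.
apply/andP; split; [rewrite [leLHS]avg | rewrite [leRHS]avg].
- rewrite lee_pmul2r//; apply: lee_sum => i _.
  exact: skyline_event_ge.
- rewrite lee_pmul2r//; apply: lee_sum => i _.
  exact: (@skyline_event_le _ _ u).
Unshelve. all: end_near. Qed.
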